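(* Let $\mathcal K$ be a smooth conic in the complex projective plane $\mathbb P^2$. Let $\Gamma$ be a hexad, i.e. six distinct points $A,B,C,D,E,F$ on $\mathcal K$, and assume that $s,t$ are two distinct labels such that the Pascal lines $k(s)$ and $k(t)$ of $\Gamma$ are equal. Then $\Gamma$ is either in involution or in ricochet configuration.
   Context: **Pascal lines.** Given six distinct points $X_1,X_2,X_3,Y_1,Y_2,Y_3$ on a smooth conic $\mathcal K\subset\mathbb P^2$ (over $\mathbb C$), arranged in an array $\left[\begin{smallmatrix} X_1&X_2&X_3\\ Y_1&Y_2&Y_3\end{smallmatrix}\right]$, Pascal's theorem says that the three points $X_1Y_2\cap X_2Y_1$, $X_1Y_3\cap X_3Y_1$, $X_2Y_3\cap X_3Y_2$ are collinear; the line containing them is the Pascal line (the Pascal) of the array, denoted $\left\{\begin{smallmatrix} X_1&X_2&X_3\\ Y_1&Y_2&Y_3\end{smallmatrix}\right\}$. Here $XY$ denotes the line joining $X$ and $Y$. Permuting the rows or the columns of the array does not change the Pascal, so six points give $6!/(2\cdot 3!)=60$ classes of arrays. **Hexads.** A hexad is an injective map from the set of letters $\{\mathbb A,\mathbb B,\mathbb C,\mathbb D,\mathbb E,\mathbb F\}$ to $\mathcal K$; the images are written $A,B,C,D,E,F$. **Labels.** A label is a symbol $(a,bc)=(a,cb)$ with $a\in\{1,\dots,6\}$ and $\{b,c\}$ a $2$-element subset of $\{1,\dots,6\}\setminus\{a\}$; there are $60$ labels. They are in bijection with the $60$ classes of arrays (modulo row and column permutations) as follows. To every $2$-element subset of $\{1,\dots,6\}$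 one associates a partition of the six letters into three pairs: $12\mapsto AE.BD.CF$, $13\mapsto AD.BF.CE$, $14\mapsto AB.CD.EF$, $15\mapsto AF.BC.DE$, $16\mapsto AC.BE.DF$, $23\mapsto AF.BE.CD$, $24\mapsto AC.BF.DE$, $25\mapsto AB.CE.DF$, $26\mapsto AD.BC.EF$, $34\mapsto AE.BC.DF$, $35\mapsto AC.BD.EF$, $36\mapsto AB.CF.DE$, $45\mapsto AD.BE.CF$, $46\mapsto AF.BD.CE$, $56\mapsto AE.BF.CD$. The label $(a,bc)$ corresponds to the class of the array $\left[\begin{smallmatrix} X_1&X_2&X_3\\ Y_1&Y_2&Y_3\end{smallmatrix}\right]$ for which $\{X_1Y_2,\,X_2Y_3,\,X_3Y_1\}$ and $\{X_1Y_3,\,X_2Y_1,\,X_3Y_2\}$ are (in some order) the partitions associated to $ab$ and $ac$. The Pascal of this array is denoted $k(a,bc)$. For example $k(1,23)=\left\{\begin{smallmatrix} A&B&C\\ F&E&D\end{smallmatrix}\right\}$. **In involution.** Six distinct points on $\mathcal K$ are in involution if they can be partitioned into three pairs such that the three lines joining the points of each pair are concurrent in a point $Q$ (necessarily not on $\mathcal K$). **Ricochet configuration.** Six distinct points on $\mathcal K$ are in ricochet configuration if they can be named $A,B,C,D,E,F$ (in some order) so that they arise by the following construction. Start with $A,B,C,D$ on $\mathcal K$. Let $V$ be the intersection point of the tangents to $\mathcal K$ at $A$ and $C$, and let $F$ be the second intersection point of the line $VD$ with $\mathcal K$. Let $W=AF\cap CD$. Let $Z$ be the second intersection point of the line $VB$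 with $\mathcal K$, and let $E$ be the second intersection point of the line $WZ$ with $\mathcal K$ (intersections are counted with multiplicity, so $E=Z$ if $WZ$ is tangent to $\mathcal K$ at $Z$). *)

(* Defs.v *)
(* The statement is over the complex numbers R[i], R : realType. *)
From HB Require Import structures.
From mathcomp Require Import all_boot all_order all_fingroup all_algebra.
From mathcomp Require Import reals complex.

Set Implicit Arguments.
Unset Strict Implicit.
Unset Printing Implicit Defensive.

Import GRing.Theory.
Local Open Scope ring_scope.

Inductive letter := LA | LB | LC | LD | LE | LF.

Definition ord_of_letter (x : letter) : 'I_6 :=
  match x with
  | LA => @Ordinal 6 0 isT | LB => @Ordinal 6 1 isT | LC => @Ordinal 6 2 isT
  | LD => @Ordinal 6 3 isT | LE => @Ordinal 6 4 isT | LF => @Ordinal 6 5 isT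
  end.
Definition letter_of_ord (i : 'I_6) : letter :=
  nth LA [:: LA; LB; LC; LD; LE; LF] i.
Lemma ord_of_letterK : cancel ord_of_letter letter_of_ord.
Proof. by case. Qed.

HB.instance Definition _ := Equality.copy letter (can_type ord_of_letterK).
HB.instance Definition _ := Choice.copy letter (can_type ord_of_letterK).
HB.instance Definition _ := Countable.copy letter (can_type ord_of_letterK).
HB.instance Definition _ := Finite.copy letter (can_type ord_of_letterK).

Definition three_pairs (x1 y1 x2 y2 x3 y3 : letter) : {set {set letter}} :=
  [set [set x1; y1]; [set x2; y2]; [set x3; y3]].

(* The indices are 1, ..., 6; the value outside the table is irrelevant. *)
Definition syntheme (i j : nat) : {set {set letter}} :=
  match i, j with
  | 1, 2 | 2, 1 => three_pairs LA LE LB LD LC LF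
  | 1, 3 | 3, 1 => three_pairs LA LD LB LF LC LE
  | 1, 4 | 4, 1 => three_pairs LA LB LC LD LE LF
  | 1, 5 | 5, 1 => three_pairs LA LF LB LC LD LE
  | 1, 6 | 6, 1 => three_pairs LA LC LB LE LD LF
  | 2, 3 | 3, 2 => three_pairs LA LF LB LE LC LD
  | 2, 4 | 4, 2 => three_pairs LA LC LB LF LD LE
  | 2, 5 | 5, 2 => three_pairs LA LB LC LE LD LF
  | 2, 6 | 6, 2 => three_pairs LA LD LB LC LE LF
  | 3, 4 | 4, 3 => three_pairs LA LE LB LC LD LF
  | 3, 5 | 5, 3 => three_pairs LA LC LB LD LE LF
  | 3, 6 | 6, 3 => three_pairs LA LB LC LF LD LE
  | 4, 5 | 5, 4 => three_pairs LA LD LB LE LC LF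
  | 4, 6 | 6, 4 => three_pairs LA LF LB LD LC LE
  | 5, 6 | 6, 5 => three_pairs LA LE LB LF LC LD
  | _, _ => set0
  end%N.

(* The pair (a, {b, c}); the ordinal i : 'I_6 stands for the index i.+1. *)
Definition label : Type :=
  {s : 'I_6 * {set 'I_6} | (s.1 \notin s.2) && (#|s.2| == 2)}.

(* ((X1, X2, X3), (Y1, Y2, Y3)), the two rows of the array. *)
Definition array : Type :=
  ((letter * letter * letter) * (letter * letter * letter))%type.

(* As b and c range over both enumerations of the pair {b, c}, the two
   partitions of the array are matched with ab and ac in either order. *)
Definition label_array (s : label) (x : array) : bool :=
  let: ((x1, x2, x3), (y1, y2, y3)) := x in
  let: (a, bc) := val s in
  [exists b : 'I_6, exists c : 'I_6,
    [&& bc == [set b; c],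
        three_pairs x1 y2 x2 y3 x3 y1 == syntheme a.+1 b.+1 &
        three_pairs x1 y3 x2 y1 x3 y2 == syntheme a.+1 c.+1]].

(* The projective plane over k as the lattice of subspaces of k^3: points and
   lines are the subspaces of dimension 1 and 2, incidence is inclusion, the
   line joining P and Q is P + Q and the meet of L and M is L :&: M. *)
Definition point (k : fieldType) : Type :=
  {U : {vspace 'rV[k]_3} | \dim U == 1%N}.

Section Conic.
Variable k : fieldType.
Implicit Types (K : 'M[k]_3) (P Q : point k) (L : {vspace 'rV[k]_3}).

Definition on_conic K P : Prop :=
  forall v, v \in val P -> v *m K *m v^T = 0.

(* The conic v K v^T = 0 with K symmetric; 2 v K is the gradient of the
   quadratic form at v. *)
Definition smooth_conic K : Prop :=
  K^T = K /\ forall v : 'rV[k]_3, v != 0 -> v *m K *m v^T = 0 -> v *m K != 0.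

(* The line w K v^T = 0, where v spans P. *)
Definition tangent K P : {vspace 'rV[k]_3} :=
  lker (linfun (mulmxr (K *m (vpick (val P))^T)
                : 'rV[k]_3 -> 'rV[k]_1)).

(* L meets the conic in P + Q, with multiplicity. *)
Definition second_intersection K L P Q : Prop :=
  [/\ \dim L = 2%N, on_conic K P /\ on_conic K Q,
      (val P <= L)%VS /\ (val Q <= L)%VS & P = Q -> L = tangent K P].

(* The subspace spanned by the three points of Pascal's theorem. *)
Definition pascal (G : letter -> point k) (x : array) : {vspace 'rV[k]_3} :=
  let: ((x1, x2, x3), (y1, y2, y3)) := x in
  let join p q := (val (G p) + val (G q))%VS in
  ((join x1 y2 :&: join x2 y1) + (join x1 y3 :&: join x3 y1)
   + (join x2 y3 :&: join x3 y2))%VS.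

(* By label_array_exists and pascal_labelE below, an array exists and the line
   does not depend on the chosen one. *)
Definition pascal_label (G : letter -> point k) (s : label)
    : {vspace 'rV[k]_3} :=
  if [pick x | label_array s x] is Some x then pascal G x else 0%VS.

Definition in_involution (G : letter -> point k) : Prop :=
  exists (sg : {perm letter}) (Q : point k),
    let H x := val (G (sg x)) in
    [/\ (val Q <= H LA + H LB)%VS, (val Q <= H LC + H LD)%VS
      & (val Q <= H LE + H LF)%VS].

Definition ricochet_construction K (A B C D E F : point k) : Prop :=
  let V := (tangent K A :&: tangent K C)%VS in
  let W := ((val A + val F) :&: (val C + val D))%VS in
  second_intersection K (V + val D)%VS D F /\
  exists Z : point k,
    second_intersection K (V + val B)%VS B Z /\
    second_intersection K (W + val Z)%VS Z E.

Definition in_ricochet K (G : letter -> point k) : Prop :=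
  exists sg : {perm letter},
    let H x := G (sg x) in
    ricochet_construction K (H LA) (H LB) (H LC) (H LD) (H LE) (H LF).

End Conic.

(* The rest shows that pascal_label is well defined. *)

Lemma set2_eq (T : finType) (a b c d : T) :
  ([set a; b] == [set c; d]) =
  ((a == c) && (b == d)) || ((a == d) && (b == c)).
Proof.
apply/eqP/idP => [/setP e|/orP[]/andP[/eqP-> /eqP->] //]; last exact: setUC.
have := e a; have := e b; have := e c; have := e d.
rewrite !inE !eqxx ?orbT /= (eq_sym c a) (eq_sym c b) (eq_sym d a) (eq_sym d b).
by do 4![case: eqP => //= ?]; subst; rewrite ?eqxx.
Qed.

Definition six : Type :=
  (letter * letter * letter * letter * letter * letter)%type.

Definition pairs_of (l : six) : {set {set letter}} :=
  let: (x1, y1, x2, y2, x3, y3) := l in three_pairs x1 y1 x2 y2 x3 y3.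

Definition syntheme_six (i j : nat) : option six :=
  match i, j with
  | 1, 2 | 2, 1 => Some (LA, LE, LB, LD, LC, LF)
  | 1, 3 | 3, 1 => Some (LA, LD, LB, LF, LC, LE)
  | 1, 4 | 4, 1 => Some (LA, LB, LC, LD, LE, LF)
  | 1, 5 | 5, 1 => Some (LA, LF, LB, LC, LD, LE)
  | 1, 6 | 6, 1 => Some (LA, LC, LB, LE, LD, LF)
  | 2, 3 | 3, 2 => Some (LA, LF, LB, LE, LC, LD)
  | 2, 4 | 4, 2 => Some (LA, LC, LB, LF, LD, LE)
  | 2, 5 | 5, 2 => Some (LA, LB, LC, LE, LD, LF)
  | 2, 6 | 6, 2 => Some (LA, LD, LB, LC, LE, LF)
  | 3, 4 | 4, 3 => Some (LA, LE, LB, LC, LD, LF)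
  | 3, 5 | 5, 3 => Some (LA, LC, LB, LD, LE, LF)
  | 3, 6 | 6, 3 => Some (LA, LB, LC, LF, LD, LE)
  | 4, 5 | 5, 4 => Some (LA, LD, LB, LE, LC, LF)
  | 4, 6 | 6, 4 => Some (LA, LF, LB, LD, LC, LE)
  | 5, 6 | 6, 5 => Some (LA, LE, LB, LF, LC, LD)
  | _, _ => None
  end%N.

Lemma synthemeE (i j : nat) :
  syntheme i j = oapp pairs_of set0 (syntheme_six i j).
Proof. by do 7?[case: i => [|i]] => //; do 7?[case: j => [|j]]. Qed.

Definition eq_pair (x y x' y' : letter) :=
  ((x == x') && (y == y')) || ((x == y') && (y == x')).

Definition in_six (x y : letter) (l : six) :=
  let: (x1, y1, x2, y2, x3, y3) := l in
  eq_pair x y x1 y1 || eq_pair x y x2 y2 || eq_pair x y x3 y3.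

Definition sub_six (l m : six) :=
  let: (x1, y1, x2, y2, x3, y3) := l in
  [&& in_six x1 y1 m, in_six x2 y2 m & in_six x3 y3 m].

Lemma pairs_of_eq (l m : six) :
  (pairs_of l == pairs_of m) = sub_six l m && sub_six m l.
Proof.
move: l m => [[[[[x1 y1] x2] y2] x3] y3] [[[[[u1 v1] u2] v2] u3] v3].
rewrite /pairs_of /sub_six /in_six /eq_pair /= /three_pairs.
by rewrite eqEsubset !subUset !sub1set !inE !set2_eq -!andbA.
Qed.

Definition partner (l : six) (x : letter) : letter :=
  let: (x1, y1, x2, y2, x3, y3) := l in
  if x == x1 then y1 else if x == y1 then x1 else
  if x == x2 then y2 else if x == y2 then x2 else
  if x == x3 then y3 else x3.

Definition letters := [:: LA; LB; LC; LD; LE; LF].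
Definition indices : seq nat := [:: 1; 2; 3; 4; 5; 6]%N.

Lemma mem_letters x : x \in letters. Proof. by case: x. Qed.
Lemma mem_indices (i : 'I_6) : i.+1 \in indices.
Proof. by case: i; do 6?[case=> //]. Qed.

Lemma in_six_partner (i j : nat) l x y : i \in indices -> j \in indices ->
  syntheme_six i j = Some l -> in_six x y l -> y = partner l x /\ x = partner l y.
Proof.
move=> hi hj e h.
have : all (fun i => all (fun j => all (fun x => all (fun y =>
    if syntheme_six i j is Some l
    then in_six x y l ==> (y == partner l x) && (x == partner l y) else true)
    letters) letters) indices) indices by vm_compute.
move=> /allP/(_ i hi)/allP/(_ j hj)/allP/(_ x (mem_letters x)).
move=> /allP/(_ y (mem_letters y)).
by rewrite e h => /andP[/eqP ? /eqP ?].
Qed.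

(* The hexagon formed by the two partitions, traversed from X1. *)
Definition hexagon (p q : six) (x1 : letter) : array :=
  let y2 := partner p x1 in let x3 := partner q y2 in
  let y1 := partner p x3 in let x2 := partner q y1 in
  let y3 := partner p x2 in ((x1, x2, x3), (y1, y2, y3)).

Definition array_class (x : array) : seq array :=
  let: ((x1, x2, x3), (y1, y2, y3)) := x in
  let f x1 x2 x3 y1 y2 y3 : seq array :=
    [:: ((x1, x2, x3), (y1, y2, y3)); ((y1, y2, y3), (x1, x2, x3))] in
  f x1 x2 x3 y1 y2 y3 ++ f x1 x3 x2 y1 y3 y2 ++ f x2 x1 x3 y2 y1 y3 ++
  f x2 x3 x1 y2 y3 y1 ++ f x3 x1 x2 y3 y1 y2 ++ f x3 x2 x1 y3 y2 y1.

Lemma pascal_class (k : fieldType) (G : letter -> point k) x y :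
  y \in array_class x -> pascal G y = pascal G x.
Proof.
move: x => [[[x1 x2] x3] [[y1 y2] y3]].
have rows a b c d e f :
    pascal G ((d, e, f), (a, b, c)) = pascal G ((a, b, c), (d, e, f)).
  rewrite /pascal /=; congr (_ + _ + _)%VS; rewrite capvC.
  - by rewrite (addvC (val (G e))) (addvC (val (G d))).
  - by rewrite (addvC (val (G f))) (addvC (val (G d))).
  - by rewrite (addvC (val (G f))) (addvC (val (G e))).
have c23 a b c d e f :
    pascal G ((a, c, b), (d, f, e)) = pascal G ((a, b, c), (d, e, f)).
  rewrite /pascal /= [X in (_ + X)%VS]capvC; congr (_ + _)%VS; exact: addvC.
have c12 a b c d e f :
    pascal G ((b, a, c), (e, d, f)) = pascal G ((a, b, c), (d, e, f)).
  by rewrite /pascal /= [X in (X + _ + _)%VS]capvC -!addvA; congr (_ + _)%VS; exact: addvC.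
rewrite /array_class !inE.
do 11?[case/orP]; move=> /eqP ->;
  first [by [] | by rewrite rows | by rewrite c23 | by rewrite rows c23
    | by rewrite c12 | by rewrite rows c12 | by rewrite c12 c23
    | by rewrite rows c12 c23 | by rewrite c23 c12 | by rewrite rows c23 c12
    | by rewrite c12 c23 c12 | by rewrite rows c12 c23 c12].
Qed.

Lemma hexagonP (a b c : nat) x1 :
  a \in indices -> b \in indices -> c \in indices ->
  a != b -> a != c -> b != c ->
  exists p q, [/\ syntheme_six a b = Some p, syntheme_six a c = Some q,
    forall y, hexagon p q y \in array_class (hexagon p q x1) &
    forall y, hexagon q p y \in array_class (hexagon p q x1)] /\
    (let: ((x1, x2, x3), (y1, y2, y3)) := hexagon p q x1 in
     three_pairs x1 y2 x2 y3 x3 y1 = pairs_of p /\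
     three_pairs x1 y3 x2 y1 x3 y2 = pairs_of q).
Proof.
move=> ha hb hc ab ac bc.
have : all (fun a => all (fun b => all (fun c => all (fun x1 =>
    [&& a != b, a != c & b != c] ==>
    if (syntheme_six a b, syntheme_six a c) is (Some p, Some q) then
      all (fun y => (hexagon p q y \in array_class (hexagon p q x1)) &&
                    (hexagon q p y \in array_class (hexagon p q x1))) letters
      && let: ((x1, x2, x3), (y1, y2, y3)) := hexagon p q x1 in
         let l := (x1, y2, x2, y3, x3, y1) in
         let m := (x1, y3, x2, y1, x3, y2) in
         [&& sub_six l p, sub_six p l, sub_six m q & sub_six q m]
    else false) letters) indices) indices) indices by vm_compute.
move=> /allP/(_ a ha)/allP/(_ b hb)/allP/(_ c hc)/allP/(_ x1 (mem_letters x1)).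
move=> /implyP; rewrite ab ac bc => /(_ isT).
case: (syntheme_six a b) => // p; case: (syntheme_six a c) => // q.
move=> /andP[/allP h]; move: h.
case eqh : (hexagon p q x1) => [[[u1 u2] u3] [[v1 v2] v3]] h.
move=> /and4P[h1 h2 h3 h4]; exists p, q; rewrite eqh; split.
  by split=> // y; have /andP[] := h y (mem_letters y).
split; apply/eqP.
  rewrite [_ == _](pairs_of_eq (u1, v2, u2, v3, u3, v1) p).
  by case: eqh => <- <- <- <- <- <-; apply/andP.
rewrite [_ == _](pairs_of_eq (u1, v3, u2, v1, u3, v2) q).
by case: eqh => <- <- <- <- <- <-; apply/andP.
Qed.

Lemma labelP (s : label) : exists a b c : 'I_6,
  [/\ val s = (a, [set b; c]), a != b, a != c & b != c].
Proof.
case: s => -[a bc] /= /andP[abc /cards2P [b [c [bc' e]]]]; subst bc.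
by exists a, b, c; move: abc; rewrite !inE negb_or => /andP[].
Qed.

Lemma label_array_hexagon (s : label) x (a b c : 'I_6) p q :
  label_array s x -> val s = (a, [set b; c]) -> b != c ->
  syntheme_six a.+1 b.+1 = Some p -> syntheme_six a.+1 c.+1 = Some q ->
  exists x1, x = hexagon p q x1 \/ x = hexagon q p x1.
Proof.
move: x => [[[x1 x2] x3] [[y1 y2] y3]]; rewrite /label_array => + es bc ep eq.
rewrite es => /existsP[b' /existsP[c' /and3P[e h1 h2]]]; exists x1.
have main d d' u v : syntheme_six a.+1 d.+1 = Some u ->
    syntheme_six a.+1 d'.+1 = Some v -> d.+1 \in indices -> d'.+1 \in indices ->
    three_pairs x1 y2 x2 y3 x3 y1 == syntheme a.+1 d.+1 ->
    three_pairs x1 y3 x2 y1 x3 y2 == syntheme a.+1 d'.+1 ->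
    ((x1, x2, x3), (y1, y2, y3)) = hexagon u v x1.
  move=> eu ev hd hd'; rewrite !synthemeE eu ev /=.
  rewrite [_ == _](pairs_of_eq (x1, y2, x2, y3, x3, y1) u).
  move=> /andP[/and3P[i1 i2 i3] _].
  rewrite [_ == _](pairs_of_eq (x1, y3, x2, y1, x3, y2) v).
  move=> /andP[/and3P[j1 j2 j3] _].
  have P := in_six_partner (mem_indices a) hd eu.
  have Q := in_six_partner (mem_indices a) hd' ev.
  rewrite /hexagon -(P _ _ i1).1 -(Q _ _ j3).2 -(P _ _ i3).1 -(Q _ _ j2).2.
  by rewrite -(P _ _ i2).1.
move: e h1 h2; rewrite set2_eq => /orP[]/andP[/eqP <- /eqP <-] h1 h2.
  by left; apply: main h1 h2; rewrite ?mem_indices.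
by right; apply: main h1 h2; rewrite ?mem_indices.
Qed.

Lemma label_array_exists (s : label) : exists x, label_array s x.
Proof.
have [a [b [c [es ab ac bc]]]] := labelP s.
have [] := @hexagonP a.+1 b.+1 c.+1 LA; rewrite ?mem_indices ?eqSS //.
move=> p [q [[ep eq _ _] [h1 h2]]]; exists (hexagon p q LA).
rewrite /label_array es; apply/existsP; exists b; apply/existsP; exists c.
by rewrite !synthemeE ep eq; apply/and3P; split; apply/eqP.
Qed.

Lemma pascal_labelE (k : fieldType) (G : letter -> point k) (s : label) x :
  label_array s x -> pascal_label G s = pascal G x.
Proof.
rewrite /pascal_label => hx; case: pickP => [y hy|/(_ x)]; last by rewrite hx.
have [a [b [c [es ab ac bc]]]] := labelP s.
have [] := @hexagonP a.+1 b.+1 c.+1 LA; rewrite ?mem_indices ?eqSS //.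
move=> p [q [[ep eq h1 h2] _]].
have rep z : label_array s z -> pascal G z = pascal G (hexagon p q LA).
  move=> hz; have [z1 [] ->] := label_array_hexagon hz es bc ep eq;
    exact: pascal_class.
by rewrite (rep _ hx) (rep _ hy).
Qed.

(* Main.v *)
(* Relabelling the letters, one may assume that one of the two Pascals is that of
   the array ABC/FED, i.e. s = (1,23), and that t is one of 11 labels, one for
   each orbit of the stabiliser of (1,23).  Parametrise the conic by
   (u^2, uw, w^2) so that A, B, C, D, E, F have parameters oo, 0, 1, d, e, f;
   then k(s) has coordinates (e - d, df + d - ef - f, ef - de).  If k(s) = k(t),
   this line contains the three points that define k(t).  For 6 of the labels t
   one of these incidences is a product of differences of the parameters
   equated to 0, which is absurd; for 4 of them one incidence is such a product
   times the condition that the six points be in involution; for t = (1,45) two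
   incidences give the conditions of the ricochet construction. *)
Require Import Defs.
From HB Require Import structures.
From mathcomp Require Import all_boot all_order all_fingroup all_algebra.
From mathcomp Require Import reals complex.
From mathcomp Require Import ring.

Set Implicit Arguments.
Unset Strict Implicit.
Unset Printing Implicit Defensive.

Import GRing.Theory.
Local Open Scope ring_scope.

(** * Coordinates on the conic *)

Section Coordinates.
Variable k : fieldType.
Implicit Types (l m n t x y : k * k * k) (p q r s : k * k) (M : 'M[k]_3).

Definition dot l x := l.1.1 * x.1.1 + l.1.2 * x.1.2 + l.2 * x.2.

Definition cross l m : k * k * k :=
  (l.1.2 * m.2 - l.2 * m.1.2, l.2 * m.1.1 - l.1.1 * m.2,
   l.1.1 * m.1.2 - l.1.2 * m.1.1).

(** The symmetric bilinear form attached to the quadratic form x z - y^2, which vanishes at the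
    points [veronese p]; [polar x x] is twice the value of that form. *)
Definition polar x y := x.1.1 * y.2 + x.2 * y.1.1 - (x.1.2 * y.1.2) *+ 2.

(** For nonzero pairs it vanishes exactly when they are homogeneous coordinates of the same point of
    the projective line. *)
Definition bracket p q := p.1 * q.2 - p.2 * q.1.

Definition veronese p : k * k * k := (p.1 ^+ 2, p.1 * p.2, p.2 ^+ 2).

(* For p = q this is the tangent. *)
Definition chord p q : k * k * k :=
  (p.2 * q.2, - (p.1 * q.2 + q.1 * p.2), p.1 * q.1).

Definition scale a t : k * k * k := (a * t.1.1, a * t.1.2, a * t.2).

Definition row3 t : 'rV[k]_3 := \row_(j < 3) [:: t.1.1; t.1.2; t.2]`_j.

Definition emb M t : 'rV[k]_3 := row3 t *m M.

(** The factor [invmx M] makes [l] the coordinates of the line in the frame [M]: incidence with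
    [emb M t] becomes [dot l t = 0]. *)
Definition line M l : {vspace 'rV[k]_3} :=
  lker (linfun (mulmxr (invmx M *m (row3 l)^T) : 'rV[k]_3 -> 'rV[k]_1)).

Definition conic_point M p := <[emb M (veronese p)]>%VS.

Lemma pair_neq0 p : (p != 0) = (p.1 != 0) || (p.2 != 0).
Proof. by case: p => a b; rewrite -negb_and. Qed.

Lemma triple_neq0 t : t != 0 -> [\/ t.1.1 != 0, t.1.2 != 0 | t.2 != 0].
Proof.
case: t => [[a b] c] /=; case: (eqVneq a 0) => [->|]; last by constructor.
case: (eqVneq b 0) => [->|]; last by constructor.
by case: (eqVneq c 0) => [->|]; [rewrite eqxx | constructor].
Qed.

Lemma cross_scalel a x y : cross (scale a x) y = scale a (cross x y).
Proof. by rewrite /cross /scale /=; congr (_, _, _); ring. Qed.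

Lemma cross_self x : cross x x = 0.
Proof. by rewrite /cross; congr (_, _, _); ring. Qed.

Lemma scale0 a : scale a 0 = 0.
Proof. by rewrite /scale /=; congr (_, _, _); ring. Qed.

Lemma scale_eq0 a t : (scale a t == 0) = (a == 0) || (t == 0).
Proof.
apply/eqP/orP => [[h0 h1 h2]|[/eqP ->|/eqP ->]]; last exact: scale0.
  case: (eqVneq a 0) => [|a0]; first by left.
  right; case: t h0 h1 h2 => [[t0 t1] t2] /= h0 h1 h2; apply/eqP.
  by congr (_, _, _); apply: (mulfI a0); rewrite mulr0.
by rewrite /scale !mul0r.
Qed.

Lemma cross_eq0_scale x y : y != 0 -> cross x y = 0 -> exists a, x = scale a y.
Proof.
case: x y => [[x0 x1] x2] [[y0 y1] y2] y_neq0 [].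
move=> /subr0_eq h0 /subr0_eq h1 /subr0_eq h2.
have E (a b c d : k) : b != 0 -> c * b = a * d -> c = a / b * d.
  by move=> b0 e; rewrite mulrAC -e mulfK.
case/triple_neq0: y_neq0 => /= yj; [exists (x0 / y0) | exists (x1 / y1)
  | exists (x2 / y2)]; rewrite /scale /=; congr (_, _, _); apply: E => //;
  by rewrite ?h0 ?h1 ?h2 // -?h0 -?h1 -?h2.
Qed.

(** By the triple product identity, [cross x (cross l m)] is [dot m x] times [l] minus [dot l x]
    times [m]. *)
Lemma double_cross_eq0 l m x : dot l x = 0 -> dot m x = 0 ->
  cross x (cross l m) = 0.
Proof.
rewrite /dot => lx mx; rewrite /cross /=; congr (_, _, _).
- transitivity (l.1.1 * dot m x - m.1.1 * dot l x); first by rewrite /dot; ring.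
  by rewrite /dot lx mx; ring.
- transitivity (l.1.2 * dot m x - m.1.2 * dot l x); first by rewrite /dot; ring.
  by rewrite /dot lx mx; ring.
- transitivity (l.2 * dot m x - m.2 * dot l x); first by rewrite /dot; ring.
  by rewrite /dot lx mx; ring.
Qed.

Lemma dot_neq0 l : l != 0 -> exists t, dot l t != 0.
Proof.
by case/triple_neq0 => h; [exists (1, 0, 0) | exists (0, 1, 0)
  | exists (0, 0, 1)]; rewrite /dot /= ?mulr0 ?mulr1 ?addr0 ?add0r.
Qed.

Lemma cross_veronese p q :
  cross (veronese p) (veronese q) = scale (bracket p q) (chord p q).
Proof.
by rewrite /cross /veronese /scale /bracket /chord /=; congr (_, _, _); ring.
Qed.

Lemma veronese_neq0 p : p != 0 -> veronese p != 0.
Proof.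
rewrite pair_neq0; apply: contraL => /eqP[/eqP p1 _ /eqP p2].
by rewrite negb_or !negbK; move: p1 p2; rewrite !sqrf_eq0 => -> ->.
Qed.

(** The entries of [chord p q] are the coefficients of the product of the binary linear forms p.2 X
    - p.1 Y and q.2 X - q.1 Y, and a product of nonzero polynomials is nonzero. *)
Lemma chord_neq0 p q : p != 0 -> q != 0 -> chord p q != 0.
Proof.
case: p q => [a b] [c d]; rewrite !pair_neq0 /= => h.
apply: contraTneq => -[bd /eqP e ac]; move: e; rewrite oppr_eq0 => /eqP e.
rewrite negb_or !negbK; case/orP: h => h.
  have c0 : c = 0 by apply: (mulfI h); rewrite ac mulr0.
  by rewrite c0 eqxx -(inj_eq (mulfI h)) mulr0 -e c0 mul0r addr0 eqxx.
have d0 : d = 0 by apply: (mulfI h); rewrite bd mulr0.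
by rewrite d0 eqxx -(inj_eq (mulIf h)) mul0r -e d0 mulr0 add0r eqxx.
Qed.

Lemma dot_chordl p q : dot (chord p q) (veronese p) = 0.
Proof. by rewrite /dot /chord /veronese /=; ring. Qed.

Lemma dot_chordr p q : dot (chord p q) (veronese q) = 0.
Proof. by rewrite /dot /chord /veronese /=; ring. Qed.

Lemma polar_veroneser x p : polar x (veronese p) = dot (chord p p) x.
Proof. by rewrite /polar /dot /chord /veronese /=; ring. Qed.

Lemma polar_scale a x : polar (scale a x) (scale a x) = a ^+ 2 * polar x x.
Proof. by rewrite /polar /scale /=; ring. Qed.

(** When 2 is nonzero, this shows that two chords can meet on the conic only at a common
    endpoint. *)
Lemma polar_meet p q r s :
  polar (cross (chord p q) (chord r s)) (cross (chord p q) (chord r s)) =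
  - (bracket p r * bracket p s * bracket q r * bracket q s) *+ 2.
Proof. by rewrite /polar /cross /chord /bracket /=; ring. Qed.

Lemma row3_inj : injective row3.
Proof.
move=> [[a b] c] [[a' b'] c'] /matrixP e.
by have := (e 0 0, e 0 1, e 0 2); rewrite !mxE /= => -[[-> ->] ->].
Qed.

Lemma row3_surj (w : 'rV[k]_3) : w = row3 (w 0 0, w 0 1, w 0 2).
Proof.
apply/rowP => j; rewrite !mxE; case: j => [[|[|[|//]]] hj];
  by congr (w 0 _); apply/val_inj.
Qed.

Lemma row3Z a t : a *: row3 t = row3 (scale a t).
Proof. by apply/rowP => j; rewrite !mxE; case: j => [[|[|[|//]]] hj]. Qed.

Lemma row3_0 : row3 0 = 0.
Proof. by apply/rowP => j; rewrite !mxE; case: j => [[|[|[|//]]] hj]. Qed.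

Lemma embZ M a t : a *: emb M t = emb M (scale a t).
Proof. by rewrite /emb scalemxAl row3Z. Qed.

Lemma scalar_mx1_eq0 (a : k) : ((a%:M : 'M[k]_1) == 0) = (a == 0).
Proof.
apply/eqP/eqP => [/matrixP/(_ 0 0)|->]; last by rewrite raddf0.
by rewrite !mxE mulr1n.
Qed.

Lemma vline_point (v : 'rV[k]_3) : v != 0 ->
  exists P : point k, val P = <[v]>%VS.
Proof.
move=> v0; have dimv : \dim <[v]> == 1%N by rewrite dim_vline v0.
by exists (exist (fun U : {vspace 'rV[k]_3} => \dim U == 1%N) _ dimv).
Qed.

(** * Points, lines, joins and meets in a frame *)

Section Frame.
Variable M : 'M[k]_3.
Hypothesis Mu : M \in unitmx.

Lemma emb_inj : injective (emb M).
Proof. by move=> x y /(can_inj (mulmxK Mu)) /row3_inj. Qed.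

Lemma emb_surj w : exists t, w = emb M t.
Proof.
exists ((w *m invmx M) 0 0, (w *m invmx M) 0 1, (w *m invmx M) 0 2).
by rewrite /emb -row3_surj mulmxKV.
Qed.

Lemma emb_eq0 t : (emb M t == 0) = (t == 0).
Proof. by rewrite -(inj_eq emb_inj) /emb row3_0 mul0mx. Qed.

Lemma mem_line l t : (emb M t \in line M l) = (dot l t == 0).
Proof.
rewrite memv_ker lfunE /= /emb mulmxA mulmxK //.
have -> : row3 t *m (row3 l)^T = (dot l t)%:M.
  apply/rowP => j; rewrite !ord1 !mxE !big_ord_recl big_ord0 !mxE /= /dot.
  by rewrite mulr1n; ring.
exact: scalar_mx1_eq0.
Qed.

Lemma lines_meet l m : cross l m != 0 ->
  (line M l :&: line M m)%VS = <[emb M (cross l m)]>%VS.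
Proof.
move=> c0; apply/vspaceP => w; have [x ->] := emb_surj w.
rewrite memv_cap !mem_line; apply/andP/vlineP => [[/eqP lx /eqP mx]|[a]].
  have [a ->] := cross_eq0_scale c0 (double_cross_eq0 lx mx).
  by exists a; rewrite embZ.
rewrite embZ => /emb_inj ->; split; apply/eqP;
  by rewrite /dot /scale /cross /=; ring.
Qed.

(** Some vector lies off the line, so it is a proper subspace. The upper bound suffices, since a
    join of two points contained in it has dimension 2. *)
Lemma dim_line l : l != 0 -> (\dim (line M l) <= 2)%N.
Proof.
move=> /dot_neq0[t lt]; rewrite leqNgt; apply: contra lt => h.
rewrite -mem_line; suff -> : line M l = fullv by rewrite memvf.
by apply/eqP; rewrite eqEdim subvf dimvf.
Qed.

Lemma dim_join x y : cross x y != 0 ->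
  \dim (<[emb M x]> + <[emb M y]>) = 2%N.
Proof.
move=> c0.
have x0 : x != 0 by apply: contra c0 => /eqP ->; rewrite /cross /= !mul0r subrr.
have y0 : y != 0 by apply: contra c0 => /eqP ->; rewrite /cross /= !mulr0 subrr.
have cap0 : (<[emb M x]> :&: <[emb M y]> = 0)%VS.
  apply/eqP; rewrite -subv0; apply/subvP => w.
  rewrite memv_cap memv0 => /andP[/vlineP[a ->] /vlineP[b]].
  rewrite !embZ emb_eq0 => /emb_inj e.
  have : scale a (cross x y) == 0.
    by rewrite -cross_scalel e cross_scalel cross_self scale0.
  by rewrite !scale_eq0 (negPf c0) orbF => ->.
have := dimv_sum_cap <[emb M x]> <[emb M y]>.
by rewrite cap0 dimv0 addn0 !dim_vline !emb_eq0 x0 y0.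
Qed.

Lemma join_line l x y : cross x y != 0 -> l != 0 ->
  dot l x = 0 -> dot l y = 0 -> (<[emb M x]> + <[emb M y]>)%VS = line M l.
Proof.
move=> c0 l0 lx ly; apply/eqP; rewrite eqEdim dim_join // dim_line // andbT.
by rewrite subv_add -!memvE !mem_line lx ly eqxx.
Qed.

Lemma join_conic_points p q : p != 0 -> q != 0 -> bracket p q != 0 ->
  (conic_point M p + conic_point M q)%VS = line M (chord p q).
Proof.
move=> p0 q0 pq; apply: join_line; rewrite ?chord_neq0 ?dot_chordl ?dot_chordr //.
by rewrite cross_veronese scale_eq0 negb_or pq chord_neq0.
Qed.

Lemma conic_point_eq p q : p != 0 -> q != 0 ->
  conic_point M p = conic_point M q <-> bracket p q = 0.
Proof.
move=> p0 q0; split=> [e|pq].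
  have : emb M (veronese p) \in conic_point M q by rewrite -e memv_line.
  move=> /vlineP[a]; rewrite embZ => /emb_inj e'.
  have : cross (veronese p) (veronese q) == 0.
    by rewrite e' cross_scalel cross_self scale0.
  by rewrite cross_veronese scale_eq0 (negPf (chord_neq0 p0 q0)) orbF => /eqP.
have sub r s : s != 0 -> bracket r s = 0 ->
    (conic_point M r <= conic_point M s)%VS.
  move=> s0 rs; rewrite -memvE.
  have [] := @cross_eq0_scale (veronese r) _ (veronese_neq0 s0).
    by rewrite cross_veronese rs /scale !mul0r.
  by move=> a ->; rewrite -embZ memvZ ?memv_line.
apply/subv_anti; rewrite !sub //.
by rewrite /bracket -opprB -[RHS]oppr0 -pq /bracket; congr (- _); ring.
Qed.

Hypothesis two_neq0 : (2 : k) != 0.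

Lemma polar_neq0 x : polar x x != 0 -> x != 0.
Proof. by apply: contra => /eqP ->; rewrite /polar /= !mul0r mul0rn subr0 addr0. Qed.

Lemma polar_meet_neq0 p q r s : bracket p r != 0 -> bracket p s != 0 ->
  bracket q r != 0 -> bracket q s != 0 ->
  polar (cross (chord p q) (chord r s)) (cross (chord p q) (chord r s)) != 0.
Proof.
move=> pr ps qr qs; rewrite polar_meet -mulr_natr !mulf_neq0 //.
by rewrite oppr_eq0 !mulf_neq0.
Qed.

Lemma bracketC p q : bracket q p = - bracket p q.
Proof. by rewrite /bracket; ring. Qed.

(** * Tangents, second intersections and the ricochet construction *)

Section Form.
Variables (K : 'M[k]_3) (c : k).
Hypothesis c_neq0 : c != 0.
Hypothesis formE :
  forall x y, emb M x *m K *m (emb M y)^T = (c * polar x y)%:M.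

Lemma on_conic_conic_point (P : point k) p :
  val P = conic_point M p -> on_conic K P.
Proof.
move=> e v; rewrite e => /vlineP[a ->].
rewrite -scalemxAl -scalemxAl linearZ /= -scalemxAr formE.
rewrite polar_veroneser dot_chordl mulr0 raddf0.
by rewrite !scaler0.
Qed.

Lemma tangent_chord (P : point k) p : p != 0 -> val P = conic_point M p ->
  tangent K P = line M (chord p p).
Proof.
(* The vector picked by [tangent] is only known to be a nonzero multiple of [emb M (veronese p)];
   the factor does not change the kernel. *)
move=> p0 e; rewrite /tangent e; have := memv_pick (conic_point M p).
have := vpick0 (conic_point M p); set v := vpick _ => + /vlineP[a ev].
have -> : (conic_point M p == 0%VS) = false.
  apply/negbTE; rewrite -dimv_eq0 dim_vline emb_eq0.
  by rewrite veronese_neq0.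
rewrite ev scaler_eq0 => /norP[a0 _].
apply/vspaceP => w; have [x ->] := emb_surj w; rewrite [RHS]mem_line.
rewrite memv_ker lfunE /= mulmxA linearZ /= -scalemxAr formE.
rewrite scalemx_eq0 (negPf a0) scalar_mx1_eq0 mulf_eq0 (negPf c_neq0) /=.
by rewrite polar_veroneser.
Qed.

Lemma second_intersection_chord v (P Q : point k) p q : p != 0 -> q != 0 ->
  val P = conic_point M p -> val Q = conic_point M q ->
  polar v v != 0 -> dot (chord p q) v = 0 ->
  second_intersection K (<[emb M v]> + val P)%VS P Q.
Proof.
move=> p0 q0 eP eQ v0 pqv.
(* Since [v] is off the conic, it is not proportional to [veronese p]. *)
have vp0 : cross v (veronese p) != 0.
  apply: contra v0 => /eqP /(cross_eq0_scale (veronese_neq0 p0))[a ->].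
  by rewrite polar_scale polar_veroneser dot_chordl mulr0.
have L l : l != 0 -> dot l v = 0 -> dot l (veronese p) = 0 ->
    (<[emb M v]> + val P)%VS = line M l.
  by move=> l0 lv lp; rewrite eP; apply: join_line.
have Lpq := L _ (chord_neq0 p0 q0) pqv (dot_chordl p q).
split.
- by rewrite eP dim_join.
- by split; [apply: on_conic_conic_point eP | apply: on_conic_conic_point eQ].
- by rewrite addvSr; split=> //; rewrite Lpq eQ -memvE mem_line dot_chordr.
(* If P = Q then [p] and [q] are only proportional. Multiplying [chord p p] by a nonzero coordinate
   of [q] gives the same coordinate of [p] times [chord p q], so [v] lies on the tangent. *)
move=> ePQ; rewrite (tangent_chord p0 eP).
apply: L; rewrite ?chord_neq0 ?dot_chordl //.
have pq : p.1 * q.2 = p.2 * q.1.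
  by apply/subr0_eq/(conic_point_eq p0 q0); rewrite -eP -eQ ePQ.
move: q0; rewrite pair_neq0 => /orP[] qi; apply: (mulfI qi); rewrite mulr0.
  transitivity (p.1 * dot (chord p q) v); last by rewrite pqv mulr0.
  by rewrite /dot /chord /=; ring: pq.
transitivity (p.2 * dot (chord p q) v); last by rewrite pqv mulr0.
by rewrite /dot /chord /=; ring: pq.
Qed.

(** The lines through V, the pole of AC, cut the conic in pairs harmonic with respect to A and C.
    From the identity [a c'] b = [b c'] a + [a b] c', the harmonic conjugate of [b] is obtained by
    changing one sign; this is [z], the parameter of Z. The last two hypotheses say that V lies on
    DF and W on ZE. *)
Lemma ricochet_parameters (A B C D E F : point k) (a b c' d e f : k * k) :
  val A = conic_point M a -> val B = conic_point M b ->
  val C = conic_point M c' -> val D = conic_point M d ->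
  val E = conic_point M e -> val F = conic_point M f ->
  [/\ a != 0, b != 0, c' != 0, d != 0 & e != 0] -> f != 0 ->
  bracket a b != 0 -> bracket a c' != 0 -> bracket a d != 0 ->
  bracket a f != 0 -> bracket c' d != 0 -> bracket c' f != 0 ->
  bracket d f != 0 ->
  let z := (bracket b c' * a.1 - bracket a b * c'.1,
            bracket b c' * a.2 - bracket a b * c'.2) in
  dot (chord d f) (cross (chord a a) (chord c' c')) = 0 ->
  dot (chord z e) (cross (chord a f) (chord c' d)) = 0 ->
  ricochet_construction K A B C D E F.
Proof.
move=> eA eB eC eD eE eF [a0 b0 c0 d0 e0] f0 ab ac ad af cd cf df z harm hz.
have V0 : polar (cross (chord a a) (chord c' c'))
                (cross (chord a a) (chord c' c')) != 0.
  by apply: polar_meet_neq0.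
have W0 : polar (cross (chord a f) (chord c' d))
                (cross (chord a f) (chord c' d)) != 0.
  by apply: polar_meet_neq0; rewrite // bracketC oppr_eq0.
(* The bracket of [a] and [z] is minus the product of the nonzero brackets [a b] and [a c']. *)
have z0 : z != 0.
  apply: contraNneq (mulf_neq0 ab ac) => /(congr1 (bracket a)) e'.
  rewrite -oppr_eq0; apply/eqP.
  transitivity (bracket a z); first by rewrite /z /bracket /=; ring.
  by rewrite e' /bracket /= !mulr0 subrr.
have [Z eZ] : exists Z : point k, val Z = conic_point M z.
  by apply: vline_point; rewrite emb_eq0 veronese_neq0.
rewrite /ricochet_construction (tangent_chord a0 eA) (tangent_chord c0 eC).
rewrite (lines_meet (polar_neq0 V0)).
have -> : ((val A + val F) :&: (val C + val D))%VS =
    <[emb M (cross (chord a f) (chord c' d))]>%VS.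
  by rewrite eA eF eC eD !join_conic_points // lines_meet ?polar_neq0.
split; first exact: second_intersection_chord eD eF V0 harm.
exists Z; split.
  apply: second_intersection_chord eB eZ V0 _ => //.
  by rewrite /dot /chord /cross /z /bracket /=; ring.
exact: second_intersection_chord eZ eE W0 hz.
Qed.
End Form.
End Frame.

End Coordinates.

(** * Pascal lines in coordinates *)

Section Pascal.
Variables (k : fieldType) (M : 'M[k]_3) (G : letter -> point k) (par : letter -> k * k).
Hypotheses (Mu : M \in unitmx) (two_neq0 : (2 : k) != 0).
Hypothesis G_par : forall x, val (G x) = conic_point M (par x).
Hypothesis par_neq0 : forall x, par x != 0.
Hypothesis par_inj : forall x y, x != y -> bracket (par x) (par y) != 0.

Definition node (x y z t : letter) :=
  cross (chord (par x) (par y)) (chord (par z) (par t)).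

Definition nodes (a : array) :=
  let: ((x1, x2, x3), (y1, y2, y3)) := a in
  [:: node x1 y2 x2 y1; node x1 y3 x3 y1; node x2 y3 x3 y2].

Definition array_uniq (a : array) :=
  let: ((x1, x2, x3), (y1, y2, y3)) := a in uniq [:: x1; x2; x3; y1; y2; y3].

Lemma join_letters x y : x != y ->
  (val (G x) + val (G y))%VS = line M (chord (par x) (par y)).
Proof. by move=> xy; rewrite !G_par join_conic_points // par_inj. Qed.

Lemma node_neq0 x y z t : uniq [:: x; y; z; t] -> node x y z t != 0.
Proof.
rewrite /= !inE !negb_or -!andbA => /and5P[_ xz xt yz /andP[yt _]].
by apply/polar_neq0/polar_meet_neq0 => //; apply: par_inj.
Qed.

Lemma letters_meet x y z t : uniq [:: x; y; z; t] ->
  ((val (G x) + val (G y)) :&: (val (G z) + val (G t)))%VS =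
  <[emb M (node x y z t)]>%VS.
Proof.
move=> u; have := u; rewrite /= !inE !negb_or => /and4P[/and3P[xy _ _] _ zt _].
by rewrite !join_letters // lines_meet // node_neq0.
Qed.

Lemma pascal_nodes a : array_uniq a ->
  pascal G a = (\sum_(t <- nodes a) <[emb M t]>)%VS.
Proof.
case: a => [[[x1 x2] x3] [[y1 y2] y3]] u.
rewrite /pascal !big_cons big_nil addv0 -!addvA !letters_meet //;
  move: u; rewrite /= !inE !negb_or -!andbA; do 15![case/andP=> ?];
  by move=> _; do 6?[apply/andP; split] => //; rewrite eq_sym.
Qed.

Lemma pascal_line a l : array_uniq a -> {in nodes a, forall v, dot l v = 0} ->
  (pascal G a <= line M l)%VS.
Proof.
move=> u h; rewrite pascal_nodes //; rewrite big_seq.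
elim/big_ind: _ => [|U V hU hV|t /h lt]; first exact: sub0v.
  by rewrite subv_add hU hV.
by rewrite -memvE mem_line // lt.
Qed.

(** The nodes of [b] lie on its Pascal, which is that of [a] and is contained in the line [l]. *)
Lemma pascal_eq_nodes a b l : array_uniq a -> array_uniq b ->
  pascal G a = pascal G b -> {in nodes a, forall v, dot l v = 0} ->
  {in nodes b, forall v, dot l v = 0}.
Proof.
move=> ua ub e /(pascal_line ua); rewrite e pascal_nodes // => /subvP h t tb.
apply/eqP; rewrite -(mem_line Mu); apply: h.
by rewrite (big_rem _ tb) /= memvE addvSl.
Qed.

(** The centre is the meet of the first two chords; the hypothesis puts it on the third. *)
Lemma in_involution_parameters (g : letter -> letter) : injective g ->
  dot (chord (par (g LE)) (par (g LF))) (node (g LA) (g LB) (g LC) (g LD)) = 0 ->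
  in_involution G.
Proof.
move=> gi h; have u : uniq [:: g LA; g LB; g LC; g LD].
  by rewrite (map_inj_uniq gi [:: LA; LB; LC; LD]).
have [Q eQ] : exists Q : point k,
    val Q = <[emb M (node (g LA) (g LB) (g LC) (g LD))]>%VS.
  by apply: vline_point; rewrite emb_eq0 // node_neq0.
exists (perm gi), Q; rewrite /= !permE eQ.
have := capvSl (val (G (g LA)) + val (G (g LB)))%VS (val (G (g LC)) + val (G (g LD)))%VS.
have := capvSr (val (G (g LA)) + val (G (g LB)))%VS (val (G (g LC)) + val (G (g LD)))%VS.
rewrite letters_meet // => h1 h2; split=> //.
by rewrite join_letters ?(inj_eq gi) // -memvE mem_line // h.
Qed.
End Pascal.

(** * Orbits of pairs of labels *)

Definition relabel (g : letter -> letter) (a : array) : array :=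
  let: ((x1, x2, x3), (y1, y2, y3)) := a in
  ((g x1, g x2, g x3), (g y1, g y2, g y3)).

Definition base_array : array := ((LA, LB, LC), (LF, LE, LD)).

Definition array_map (a : array) (x : letter) : letter :=
  let: ((x1, x2, x3), (y1, y2, y3)) := a in
  match x with
  | LA => x1 | LB => x2 | LC => x3 | LD => y3 | LE => y2 | LF => y1
  end.

Lemma relabel_array_map a : relabel (array_map a) base_array = a.
Proof. by case: a => [[[? ?] ?] [[? ?] ?]]. Qed.

Lemma array_map_inj a : array_uniq a -> injective (array_map a).
Proof.
case: a => [[[x1 x2] x3] [[y1 y2] y3]] u.
have H x y : x != y -> array_map ((x1, x2, x3), (y1, y2, y3)) x
                    != array_map ((x1, x2, x3), (y1, y2, y3)) y.
  move: u; rewrite /= !inE !negb_or -!andbA; do 15![case/andP=> ?] => _.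
  by case: x; case: y => // _; rewrite /= // eq_sym.
by move=> x y e; apply/eqP; apply: contraTT (introT eqP e) => /H.
Qed.

Lemma pascal_relabel (k : fieldType) (G : letter -> point k) g a :
  pascal G (relabel g a) = pascal (G \o g) a.
Proof. by case: a => [[[? ?] ?] [[? ?] ?]]. Qed.

(* The labels (1,24), (2,14), (2,45), (4,25), (4,56), (4,15), then (2,13),
   (2,34), (4,12), (4,23), and (1,45): one for each orbit, on the labels other
   than (1,23), of the stabiliser of (1,23) in the symmetric group. *)
Definition orbit_arrays : seq array :=
  [:: ((LA, LD, LF), (LC, LE, LB)); ((LA, LF, LD), (LB, LE, LC));
      ((LA, LF, LE), (LD, LC, LB)); ((LA, LE, LF), (LB, LC, LD));
      ((LA, LC, LB), (LE, LD, LF)); ((LA, LC, LE), (LF, LB, LD));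
      ((LA, LC, LB), (LD, LE, LF)); ((LA, LD, LB), (LE, LF, LC));
      ((LA, LD, LF), (LE, LB, LC)); ((LA, LD, LB), (LF, LC, LE));
      ((LA, LE, LC), (LD, LB, LF))].

(** Starting at [LA] selects one array of the class. [syntheme_six] fails only for equal or
    out-of-range indices, so the default value does not occur on [label_triples]. *)
Definition label_hexagon (t : nat * nat * nat) : array :=
  let: (a, b, c) := t in
  if (syntheme_six a b, syntheme_six a c) is (Some p, Some q)
  then hexagon p q LA else base_array.

(** The condition b < c lists each of the 60 labels exactly once. *)
Definition label_triples : seq (nat * nat * nat) :=
  [seq t <- [seq (ab, c) | ab <- [seq (a, b) | a <- indices, b <- indices],
                           c <- indices]
  | [&& t.1.1 != t.1.2, t.1.1 != t.2 & (t.1.2 < t.2)%N]].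

(* Lazy counterparts of [==] and [has]: under call by value [&&] and [||]
   would evaluate both arguments. *)
Definition eq_letter (x y : letter) : bool :=
  match x, y with
  | LA, LA | LB, LB | LC, LC | LD, LD | LE, LE | LF, LF => true
  | _, _ => false
  end.

Definition eq_array (a b : array) : bool :=
  let: ((x1, x2, x3), (y1, y2, y3)) := a in
  let: ((u1, u2, u3), (v1, v2, v3)) := b in
  if eq_letter x1 u1 then if eq_letter x2 u2 then if eq_letter x3 u3 then
  if eq_letter y1 v1 then if eq_letter y2 v2 then eq_letter y3 v3
  else false else false else false else false else false.

Fixpoint search (T : Type) (P : T -> bool) (s : seq T) : bool :=
  if s is x :: s' then if P x then true else search P s' else false.

Lemma eq_letterP x y : eq_letter x y -> x = y.
Proof. by case: x; case: y. Qed.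

Lemma eq_arrayP a b : eq_array a b -> a = b.
Proof.
case: a b => [[[x1 x2] x3] [[y1 y2] y3]] [[[u1 u2] u3] [[v1 v2] v3]] /=.
by do 5![case: ifP => // /eq_letterP ->] => /eq_letterP ->.
Qed.

Lemma searchP (T : eqType) (P : T -> bool) s :
  search P s -> exists2 x, x \in s & P x.
Proof.
elim: s => //= x s IH; case: ifP => [Px _|_ /IH[y ys Py]].
  by exists x; rewrite ?mem_head.
by exists y; rewrite // inE ys orbT.
Qed.

(** The 12 arrays in the class of [a] give the 12 relabellings that carry the class of [base_array]
    to that of [a], a coset of its stabiliser. One of them has to carry some orbit representative to
    the class of [b]. *)
Definition reduces (a b : array) : bool :=
  search (fun g => search (fun r => search (eq_array b)
    (array_class (relabel (array_map g) r))) orbit_arrays) (array_class a).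

(** A finite check over the 60 * 59 ordered pairs of distinct labels. *)
Lemma label_hexagons_reduce :
  all (fun t => all (fun u => if t == u then true
    else reduces (label_hexagon t) (label_hexagon u)) label_triples)
    label_triples.
Proof. by vm_compute. Qed.

Lemma label_hexagons_uniq :
  all (fun t => all array_uniq (array_class (label_hexagon t))) label_triples.
Proof. by vm_compute. Qed.

Lemma label_hexagons_orbit t u : t \in label_triples -> u \in label_triples ->
  t != u -> exists g r, [/\ injective g, r \in orbit_arrays,
    relabel g base_array \in array_class (label_hexagon t) &
    label_hexagon u \in array_class (relabel g r)].
Proof.
move=> ht hu tu; have := allP label_hexagons_reduce t ht => /allP/(_ u hu).
rewrite (negPf tu) => /searchP[g hg /searchP[r hr /searchP[b hb /eq_arrayP e]]].
exists (array_map g), r; rewrite relabel_array_map e; split=> //.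
apply: array_map_inj.
by have /allP/(_ g hg) := allP label_hexagons_uniq t ht.
Qed.

Lemma label_triple (s : label) : exists2 t, t \in label_triples &
  label_array s (label_hexagon t) /\
  exists a b c : 'I_6, t = (a.+1, b.+1, c.+1) /\ val s = (a, [set b; c]).
Proof.
have [a [b [c [es ab ac bc]]]] : exists a b c : 'I_6,
    [/\ val s = (a, [set b; c]), a != b, a != c & (b < c)%N].
  have [a [b [c [es ab ac bc]]]] := labelP s.
  case: (ltngtP b c) => [lt|lt|/val_inj e]; last by rewrite e eqxx in bc.
    by exists a, b, c.
  by exists a, c, b; rewrite setUC.
have bc' : b != c by rewrite neq_ltn bc.
exists (a.+1, b.+1, c.+1).
  rewrite mem_filter; apply/andP; split; first by rewrite /= !eqSS ltnS ab ac.
  apply: (allpairs_f (fun ab c => (ab, c))); rewrite ?mem_indices //.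
  by apply: (allpairs_f (fun a b => (a, b))); rewrite mem_indices.
split; last by exists a, b, c.
have [] := @hexagonP a.+1 b.+1 c.+1 LA; rewrite ?mem_indices ?eqSS //.
move=> p [q [[ep eq _ _]]]; rewrite /label_hexagon ep eq => -[h1 h2].
rewrite /label_array es; apply/existsP; exists b; apply/existsP; exists c.
by rewrite !synthemeE ep eq; apply/and3P; split; apply/eqP.
Qed.

(** Replacing the hexad [G] by [G \o g] turns any two distinct labels into (1,23) and one of the 11
    representatives; [g] depends on the labels alone. *)
Lemma label_pair_orbit (s t : label) : s <> t -> exists g r,
  [/\ injective g, r \in orbit_arrays &
    forall (k : fieldType) (G : letter -> point k),
      pascal_label G s = pascal (G \o g) base_array /\
      pascal_label G t = pascal (G \o g) r].
Proof.
move=> st; have [u hu [su [a [b [c [eu es]]]]]] := label_triple s.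
have [v hv [tv [a' [b' [c' [ev et]]]]]] := label_triple t.
have uv : u != v.
  apply/eqP => uv; apply: st; apply: val_inj; rewrite es et.
  by move: uv; rewrite eu ev => -[/val_inj -> /val_inj -> /val_inj ->].
have [g [r [gi hr hg hr']]] := label_hexagons_orbit hu hv uv.
exists g, r; split=> // k G; split.
  by rewrite (pascal_labelE _ su) -(pascal_class _ hg) pascal_relabel.
by rewrite (pascal_labelE _ tv) (pascal_class _ hr') pascal_relabel.
Qed.

(** * Choice of coordinates *)

Section Normalisation.
Variables (k : fieldType) (K : 'M[k]_3).
Hypotheses (two_neq0 : (2 : k) != 0) (hK : smooth_conic K).
Implicit Types (u v w : 'rV[k]_3) (P Q : point k).

Definition bilin u v : k := (u *m K *m v^T) 0 0.

Lemma bilinE u v : u *m K *m v^T = (bilin u v)%:M.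
Proof. by rewrite [LHS]mx11_scalar. Qed.

Lemma bilinC u v : bilin u v = bilin v u.
Proof.
by rewrite /bilin -[u *m K *m v^T]trmxK mxE !trmx_mul trmxK hK.1 mulmxA.
Qed.

Lemma bilinDl u v w : bilin (u + v) w = bilin u w + bilin v w.
Proof. by rewrite /bilin !mulmxDl mxE. Qed.

Lemma bilinZl a u v : bilin (a *: u) v = a * bilin u v.
Proof. by rewrite /bilin -!scalemxAl mxE. Qed.

Lemma bilinDr u v w : bilin w (u + v) = bilin w u + bilin w v.
Proof. by rewrite !(bilinC w) bilinDl. Qed.

Lemma bilinZr a u v : bilin v (a *: u) = a * bilin v u.
Proof. by rewrite !(bilinC v) bilinZl. Qed.

Lemma point_vline P : exists2 v, v != 0 & val P = <[v]>%VS.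
Proof.
have v0 : vpick (val P) != 0 by rewrite vpick0 -dimv_eq0 (eqP (valP P)).
exists (vpick (val P)) => //; apply/esym/eqP.
by rewrite eqEdim dim_vline v0 (eqP (valP P)) -memvE memv_pick.
Qed.

(** A nonzero vector of the kernel would be a singular point of the conic. *)
Lemma smooth_unitmx : K \in unitmx.
Proof.
rewrite -row_free_unit -kermx_eq0; apply/eqP/row_matrixP => i.
rewrite row0; apply/eqP/negPn/negP => r0.
have rK : row i (kermx K) *m K = 0 by rewrite -row_mul mulmx_ker row0.
by have := hK.2 _ r0; rewrite rK mul0mx eqxx => /(_ erefl).
Qed.

(* Otherwise u and v would span a totally isotropic plane, of dimension more
   than half of 3. *)
Lemma bilin_neq0 u v : v != 0 -> u \notin <[v]>%VS ->
  bilin u u = 0 -> bilin v v = 0 -> bilin u v != 0.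
Proof.
move=> v0 uv uu vv; apply/eqP => b0; pose A := col_mx u v.
have rA : row_free A.
  rewrite -kermx_eq0; apply/eqP/row_matrixP => i; rewrite row0.
  set x := row i _; have : x *m A = 0 by rewrite -row_mul mulmx_ker row0.
  rewrite -[x]hsubmxK mul_row_col [lsubmx x]mx11_scalar [rsubmx x]mx11_scalar.
  rewrite !mul_scalar_mx; set a := lsubmx x 0 0; set b := rsubmx x 0 0 => e.
  have a0 : a = 0.
    apply/eqP/negPn/negP => a0; case/negP: uv; apply/vlineP; exists (- (b / a)).
    apply: (scalerI a0); rewrite scalerA mulrN mulrCA divff // mulr1 scaleNr.
    by apply/eqP; rewrite -addr_eq0 e.
  move/eqP: e; rewrite a0 scale0r add0r scaler_eq0 (negPf v0) orbF => /eqP ->.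
  by rewrite !raddf0 row_mx0.
have : A *m K *m A^T = 0.
  rewrite /A mul_col_mx tr_col_mx mul_mx_row !mul_col_mx !bilinE uu vv.
  by rewrite (bilinC v u) b0 !raddf0 !col_mx0 row_mx0.
(* The ranks of [A *m K] and [A^T] are both 2, yet would add up to at most 3. *)
move/mulmx0_rank_max; rewrite mxrank_tr mxrankMfree ?row_free_unit ?smooth_unitmx //.
by rewrite (eqP rA).
Qed.

Lemma conic_points_bilin P Q u v : P <> Q -> on_conic K P -> on_conic K Q ->
  v != 0 -> val P = <[u]>%VS -> val Q = <[v]>%VS -> bilin u v != 0.
Proof.
move=> PQ hP hQ v0 eP eQ; apply: bilin_neq0 => //.
- apply/negP => uv; apply: PQ; apply: val_inj; apply/eqP.
  by rewrite eqEdim (eqP (valP P)) (eqP (valP Q)) andbT eP eQ -memvE.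
- by rewrite /bilin hP ?mxE // eP memv_line.
- by rewrite /bilin hQ ?mxE // eQ memv_line.
Qed.

Lemma conic_frame (P1 P2 P3 : point k) :
  P1 <> P2 -> P1 <> P3 -> P2 <> P3 ->
  on_conic K P1 -> on_conic K P2 -> on_conic K P3 ->
  exists (M : 'M[k]_3) (c : k), [/\ M \in unitmx, c != 0,
    forall x y, emb M x *m K *m (emb M y)^T = (c * polar x y)%:M &
    [/\ val P1 = conic_point M (1, 0), val P2 = conic_point M (0, 1)
      & val P3 = conic_point M (1, 1)]].
Proof.
move=> n12 n13 n23 h1 h2 h3.
have [v1 v10 e1] := point_vline P1; have [v2 v20 e2] := point_vline P2.
have [v3 v30 e3] := point_vline P3.
have b12 := conic_points_bilin n12 h1 h2 v20 e1 e2.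
have b13 := conic_points_bilin n13 h1 h3 v30 e1 e3.
have b23 := conic_points_bilin n23 h2 h3 v30 e2 e3.
have iso (P : point k) v : on_conic K P -> val P = <[v]>%VS -> bilin v v = 0.
  by move=> hP eP; rewrite /bilin hP ?mxE // eP memv_line.
have [[b11 b22] b33] := (iso _ _ h1 e1, iso _ _ h2 e2, iso _ _ h3 e3).
(* Scaled so that all mutual products are c. *)
pose w1 := bilin v2 v3 *: v1; pose w2 := bilin v1 v3 *: v2.
pose w3 := bilin v1 v2 *: v3.
(* The middle row makes [emb M] send (1, 1, 1), the Veronese image of (1, 1), to [w3]. It is
   orthogonal to [w1] and [w2] and has square -2 c, so the form becomes [c * polar]. *)
pose M : 'M[k]_3 := \matrix_(i < 3) nth 0 [:: w1; w3 - w1 - w2; w2] i.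
pose c := bilin v1 v2 * bilin v1 v3 * bilin v2 v3.
have c0 : c != 0 by rewrite !mulf_neq0.
(* Differences are written with the factor -1 so that additivity and homogeneity of [bilin] expand
   everything. *)
have embE t : emb M t =
    t.1.1 *: w1 + t.1.2 *: (w3 + (-1) *: w1 + (-1) *: w2) + t.2 *: w2.
  rewrite /emb mulmx_sum_row !big_ord_recl big_ord0 !rowK !mxE /= addr0 addrA.
  by rewrite !scaleN1r.
have form x y : emb M x *m K *m (emb M y)^T = (c * polar x y)%:M.
  rewrite bilinE !embE !(bilinDl, bilinDr, bilinZl, bilinZr); congr (_%:M).
  rewrite b11 b22 b33 (bilinC v2 v1) (bilinC v3 v1) (bilinC v3 v2).
  by rewrite /c /polar; ring.
exists M, c; split=> //.
  (* A kernel vector of [M] is orthogonal to all triples under [polar], which is nondegenerate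
     because 2 is nonzero. *)
  rewrite -row_free_unit -kermx_eq0; apply/eqP/row_matrixP => i; rewrite row0.
  set u := row i _; have : u *m M = 0 by rewrite -row_mul mulmx_ker row0.
  have [t ->] : exists t, u = row3 t by eexists; apply: row3_surj.
  rewrite -/(emb M t) => et.
  have pol y : polar t y = 0.
    apply/eqP; rewrite -(mulrI_eq0 _ (mulfI c0)) -scalar_mx1_eq0 -form et.
    by rewrite !mul0mx.
  have := (pol (1, 0, 0), pol (0, 1, 0), pol (0, 0, 1)); rewrite /polar /=.
  rewrite !mulr0 !mulr1 !mul0rn !subr0 !add0r !addr0 => -[[t2 t1] t0].
  rewrite -row3_0; congr row3; rewrite [LHS]surjective_pairing t2.
  rewrite [t.1]surjective_pairing t0; congr (_, _, _); apply/eqP.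
  by move/eqP: t1; rewrite oppr_eq0 -mulr_natr mulf_eq0 (negPf two_neq0) orbF.
have vlineZ a v : a != 0 -> <[a *: v]>%VS = <[v]>%VS.
  move=> a0; apply/subv_anti; rewrite -!memvE memvZ ?memv_line //=.
  by rewrite -{1}[v](scalerK a0) memvZ ?memv_line.
rewrite /conic_point !embE /veronese /= ?mulr0 ?mul0r ?mulr1 ?expr0n ?expr1n /=.
rewrite !scale0r !scale1r !addr0 !add0r e1 e2 e3 !vlineZ //; split=> //.
rewrite -[LHS](vlineZ _ _ b12) -/w3 !scaleN1r; congr <[_]>%VS.
by rewrite -addrA subrK addrC subrK.
Qed.

(** Coordinates (x, y, z) of Q satisfy x z = y^2. If z = 0 then y = 0 and Q = P; otherwise the
    parameter is y / z. *)
Lemma conic_parameter (M : 'M[k]_3) (c : k) P Q : M \in unitmx -> c != 0 ->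
  (forall x y, emb M x *m K *m (emb M y)^T = (c * polar x y)%:M) ->
  val P = conic_point M (1, 0) -> on_conic K Q -> P <> Q ->
  exists a, val Q = conic_point M (a, 1).
Proof.
move=> Mu c0 form eP hQ PQ; have [v v0 eQ] := point_vline Q.
have [t et] := emb_surj Mu v.
have : polar t t = 0.
  apply/eqP; rewrite -(mulrI_eq0 _ (mulfI c0)) -scalar_mx1_eq0 -form -et.
  by rewrite hQ // eQ memv_line.
case: t et => [[x y] z] et; rewrite /polar /= [z * x]mulrC -mulr2n -mulrnBl.
move/eqP; rewrite -mulr_natr mulf_eq0 (negPf two_neq0) orbF subr_eq0 => /eqP xz.
have z0 : z != 0.
  apply/eqP => z0; apply: PQ; apply: val_inj; apply/esym/eqP.
  rewrite eqEdim (eqP (valP P)) (eqP (valP Q)) andbT eP eQ -memvE et.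
  move/eqP: xz; rewrite z0 mulr0 eq_sym mulf_eq0 orbb => /eqP ->.
  apply/vlineP; exists x; rewrite embZ /scale /veronese /=; congr emb.
  by congr (_, _, _); ring.
exists (y / z); apply/eqP.
rewrite eqEdim (eqP (valP Q)) eQ -memvE dim_vline leq_b1 andbT.
apply/vlineP; exists z; rewrite embZ et /scale /veronese /=; congr emb.
congr (_, _, _); last by ring.
  by apply: (mulIf z0); rewrite xz; field.
by field.
Qed.
End Normalisation.

(** * Coincident Pascals *)

Definition normal_par (k : fieldType) (d e f : k) (x : letter) : k * k :=
  match x with
  | LA => (1, 0) | LB => (0, 1) | LC => (1, 1)
  | LD => (d, 1) | LE => (e, 1) | LF => (f, 1)
  end.

Section NormalForm.
Variables (k : fieldType) (K M : 'M[k]_3) (c d e f : k).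
Variable G : letter -> point k.
Hypotheses (two_neq0 : (2 : k) != 0) (Mu : M \in unitmx) (c_neq0 : c != 0).
Hypothesis formE :
  forall x y, emb M x *m K *m (emb M y)^T = (c * polar x y)%:M.
Hypothesis G_par : forall x, val (G x) = conic_point M (normal_par d e f x).
Hypothesis G_inj : injective G.

Local Notation par := (normal_par d e f).

Let base_line : k * k * k := (e - d, d * f + d - e * f - f, e * f - d * e).

Lemma normal_par_neq0 x : par x != 0.
Proof. by rewrite pair_neq0; case: x; rewrite /= oner_eq0 ?orbT. Qed.

Lemma normal_par_inj x y : x != y -> bracket (par x) (par y) != 0.
Proof.
apply: contraNneq => /(conic_point_eq Mu (normal_par_neq0 x) (normal_par_neq0 y)).
by rewrite -!G_par => /val_inj/G_inj ->.
Qed.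

Lemma base_nodes : {in nodes par base_array, forall v, dot base_line v = 0}.
Proof.
by move=> v; rewrite !inE => /or3P[] /eqP ->;
  rewrite /dot /node /cross /chord /=; ring.
Qed.

Lemma coincident_pascals_normal r : r \in orbit_arrays ->
  pascal G base_array = pascal G r -> in_involution G \/ in_ricochet K G.
Proof.
move=> hr heq.
have d0 : d != 0.
  apply: contraNneq (@normal_par_inj LB LD isT) => /= ->.
  by rewrite /bracket /=; apply/eqP; ring.
have e0 : e != 0.
  apply: contraNneq (@normal_par_inj LB LE isT) => /= ->.
  by rewrite /bracket /=; apply/eqP; ring.
have d1 : d - 1 != 0.
  by apply: contraNneq (@normal_par_inj LD LC isT) => /= h;
    rewrite /bracket /= mulr1 mul1r h.
have de : d - e != 0.
  by apply: contraNneq (@normal_par_inj LD LE isT) => /= h;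
    rewrite /bracket /= mulr1 mul1r h.
have df : d - f != 0.
  by apply: contraNneq (@normal_par_inj LD LF isT) => /= h;
    rewrite /bracket /= mulr1 mul1r h.
have ef : e - f != 0.
  by apply: contraNneq (@normal_par_inj LE LF isT) => /= h;
    rewrite /bracket /= mulr1 mul1r h.
have [n1 n2 n3] : [/\ dot base_line (nodes par r)`_0 = 0,
    dot base_line (nodes par r)`_1 = 0 & dot base_line (nodes par r)`_2 = 0].
  have ur : array_uniq r by apply: (allP (isT : all array_uniq orbit_arrays)).
  have N := pascal_eq_nodes Mu two_neq0 G_par normal_par_neq0 normal_par_inj
    (isT : array_uniq base_array) ur heq base_nodes.
  by split; apply: N; apply: mem_nth; case: (r) => [[[? ?] ?] [[? ?] ?]].
(* The incidences agree with the expected products only up to sign, hence the two alternatives here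
   and in [divide]. *)
have absurd (x y : k) : x != 0 -> y = 0 -> x = y \/ x = - y -> False.
  by move=> x0 -> [] e'; rewrite e' ?oppr0 eqxx in x0.
have divide (x y z : k) : x != 0 -> y = 0 -> x * z = y \/ x * z = - y -> z = 0.
  by move=> x0 -> [] e'; apply: (mulfI x0); rewrite mulr0 e' ?oppr0.
have involve a : array_uniq a -> let g := array_map a in
    dot (chord (par (g LE)) (par (g LF)))
        (node par (g LA) (g LB) (g LC) (g LD)) = 0 -> in_involution G.
  move=> ua g h.
  exact: (in_involution_parameters Mu two_neq0 G_par normal_par_neq0
    normal_par_inj (array_map_inj ua) h).
move: hr n1 n2 n3; rewrite !inE.
do 10?[case/orP]; move/eqP=> -> n1 n2 n3;
  rewrite /dot /nodes /node /cross /chord /= in n1 n2 n3.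
(* The six impossible orbits, in the order of [orbit_arrays]. *)
- by case: (absurd _ _ (mulf_neq0 d0 ef) n2); right; ring.
- by case: (absurd _ _ (mulf_neq0 d1 df) n2); right; ring.
- by case: (absurd _ _ (mulf_neq0 (mulf_neq0 e0 df) ef) n3); left; ring.
- by case: (absurd _ _ (mulf_neq0 de df) n2); left; ring.
- by case: (absurd _ _ (mulf_neq0 (mulf_neq0 d1 de) ef) n1); right; ring.
- by case: (absurd _ _ (mulf_neq0 d0 ef) n1); right; ring.
(* The four orbits in involution. Through [array_map] the arrays encode the pairs AD.BE.CF, then
   AE.BF.CD twice, then AF.BE.CD. *)
- left; apply: (involve ((LA, LD, LB), (LF, LC, LE))) => //=.
  apply: divide ef n3 _; left; rewrite /dot /node /cross /chord /=; ring.
- left; apply: (involve ((LA, LE, LB), (LD, LC, LF))) => //=.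
  apply: divide df n3 _; left; rewrite /dot /node /cross /chord /=; ring.
- left; apply: (involve ((LA, LE, LB), (LD, LC, LF))) => //=.
  apply: divide df n3 _; left; rewrite /dot /node /cross /chord /=; ring.
- left; apply: (involve ((LA, LF, LB), (LD, LC, LE))) => //=.
  apply: divide d1 n1 _; right; rewrite /dot /node /cross /chord /=; ring.
(* The label (1,45), where the letters are already in the order of the ricochet construction. *)
right; have X1 : d ^+ 2 - d * e - d + f = 0.
  by apply: divide e0 n1 _; left; ring.
have X2 : - d * f + d + e * f - e *+ 2 + f = 0.
  by apply: divide df n2 _; left; ring.
(* This says that D and F are harmonic with respect to A and C, of parameters oo and 1, so that VD
   passes through F. Likewise Z has parameter 2, and [X2] says that E lies on WZ. *)
have X3 : d + f - 2 = 0.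
  apply: (mulfI df); rewrite mulr0.
  transitivity (- ((f - 2) * (d ^+ 2 - d * e - d + f)
    + d * (- d * f + d + e * f - e *+ 2 + f))); first by ring.
  by rewrite X1 X2 !mulr0 addr0 oppr0.
exists 1%g; rewrite /= !perm1.
apply: (ricochet_parameters Mu two_neq0 c_neq0 formE); try exact: G_par;
  try exact: normal_par_neq0; try exact: normal_par_inj.
- by split; exact: normal_par_neq0.
- rewrite -[RHS]oppr0 -X3 /dot /cross /chord /=; ring.
- rewrite -X2 /dot /cross /chord /bracket /=; ring.
Qed.
End NormalForm.

(** * From the normal form to arbitrary hexads *)

Lemma coincident_pascals (k : fieldType) (K : 'M[k]_3) (G : letter -> point k) r :
  (2 : k) != 0 -> smooth_conic K -> injective G -> (forall x, on_conic K (G x)) ->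
  r \in orbit_arrays -> pascal G base_array = pascal G r ->
  in_involution G \/ in_ricochet K G.
Proof.
move=> two0 hK Gi hG hr.
have ne x y : x != y -> G x <> G y by move/eqP=> xy /Gi.
have [M [c [Mu c0 form [eA eB eC]]]] := conic_frame two0 hK (ne LA LB isT)
  (ne LA LC isT) (ne LB LC isT) (hG LA) (hG LB) (hG LC).
have aff x : LA != x -> exists a, val (G x) = conic_point M (a, 1).
  by move=> /ne; apply: conic_parameter form eA (hG x).
have [[d eD] [e eE] [f eF]] := And3 (aff LD isT) (aff LE isT) (aff LF isT).
apply: (coincident_pascals_normal (d := d) (e := e) (f := f) two0 Mu c0 form) => //.
by case.
Qed.

Lemma in_involution_comp (k : fieldType) (G : letter -> point k) g :
  injective g -> in_involution (G \o g) -> in_involution G.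
Proof.
by move=> gi [sg [Q h]]; exists (sg * perm gi)%g, Q; rewrite /= !permM !permE.
Qed.

Lemma in_ricochet_comp (k : fieldType) (K : 'M[k]_3) (G : letter -> point k) g :
  injective g -> in_ricochet K (G \o g) -> in_ricochet K G.
Proof.
by move=> gi [sg h]; exists (sg * perm gi)%g; rewrite /= !permM !permE.
Qed.

Theorem theorem4p1 (R : realType) (K : 'M[R[i]]_3) (hK : smooth_conic K)
    (G : letter -> point R[i]) (hinj : injective G)
    (hG : forall x, on_conic K (G x))
    (s t : label) (hst : s <> t)
    (heq : pascal_label G s = pascal_label G t) :
  in_involution G \/ in_ricochet K G.
Proof.
have [g [r [gi hr hGr]]] := label_pair_orbit hst.
have [es et] := hGr _ G; rewrite es et in heq.
have two0 : (2 : R[i]) != 0 by rewrite Num.Theory.pnatr_eq0.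
have [h|h] := coincident_pascals two0 hK (inj_comp hinj gi) (fun x => hG (g x)) hr heq.
  by left; apply: in_involution_comp h.
by right; apply: in_ricochet_comp h.
Qed.
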